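(* Let $T$ be a normal Suslin tree. Then for every $2 \le n < \omega$, $T$ is $n$-entangled if and only if $T$ is $n$-free. In particular, $T$ is entangled if and only if $T$ is free.
   Context: A tree is a set $T$ with a strict partial order $<_T$ such that the set of predecessors of each node is well-ordered; $\mathrm{ht}_T(x)$ is the order type of the predecessors of $x$. An $\omega_1$-tree is a tree of height $\omega_1$ with all levels countable. $T$ is normal if (a) every node $x$ with $\mathrm{ht}_T(x)+1$ less than the height of $T$ has two incomparable nodes above it, (b) every node has nodes comparable to it at every height less than the height of $T$, and (c) distinct nodes of the same limit height have different sets of predecessors. A Suslin tree is an $\omega_1$-tree with no uncountable chain and no uncountable antichain. For $1 \le m < \omega$, $T^m$ is the set of $m$-tuples of nodes of $T$ all of the same height, ordered coordinatewise: $\vec a <_{T^m} \vec b$ iff $a_i <_T b_i$ for all $i$. For injective $\vec a \in T^m$, the derived tree of dimension $m$ is $T_{\vec a} = \{\vec b \in T^m : \vec a \le_{T^m} \vec b\}$. $T$ is $m$-free if every derived tree of $T$ of dimension $m$ is Suslin, and free if it is $m$-free for all $1 \le m < \omega$. For nodes $x \ne y$, $\Delta(x,y)$ is the order type of $\{z : z \le_T x \text{ and } z \le_T y\}$. $T$ is $m$-entangled if for every sequence $\langle (a_{\xi,0},\ldots,a_{\xi,m-1}) : \xi < \omega_1\rangle$ of injective $m$-tuples of nodes of $T$ such that $\{\Delta(a_{\xi,i},a_{\xi,j}) : i<j<m,\ \xi<\omega_1\}$ is bounded in $\omega_1$, and every $g : m \to 2$, there exist $\xi < \beta < \omega_1$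 such that for all $i < m$, $a_{\xi,i} <_T a_{\beta,i}$ iff $g(i)=1$. $T$ is entangled if it is $m$-entangled for all $1 \le m < \omega$.
   Formalization: In the definition of m-entangled, the tuples of the sequence are additionally required to be pairwise disjoint; without this a constant sequence with g constantly 1 shows that no normal Suslin tree is n-entangled, although free Suslin trees consistently exist. *)

(* Defs.v *)
From mathcomp Require Import all_boot.
From mathcomp Require Import boolp classical_sets functions cardinality.
From mathcomp Require wochoice.

Set Implicit Arguments.
Unset Strict Implicit.
Unset Printing Implicit Defensive.

Local Open Scope classical_set_scope.

(* Orders are strict, given by Prop-valued relations on an arbitrary type. *)

Definition strict_order (X : Type) (lt : X -> X -> Prop) : Prop :=
  (forall x, ~ lt x x) /\ (forall x y z, lt x y -> lt y z -> lt x z).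

Definition comparable_in (X : Type) (lt : X -> X -> Prop) (x y : X) : Prop :=
  [\/ lt x y, x = y | lt y x].

Definition well_ordered (X : Type) (lt : X -> X -> Prop) (A : set X) : Prop :=
  (forall x y, A x -> A y -> comparable_in lt x y) /\
  (forall B : set X, B `<=` A -> B !=set0 ->
    exists2 b, B b & forall c, B c -> b = c \/ lt b c).

(* omega_1: fix a well-order of the uncountable type [nat -> bool] and keep the
   points with countably many predecessors. The lemmas [omega1_*] below give
   the properties that determine this well-order up to isomorphism. The
   countable ordinals are represented by the elements of [omega1]. *)

Definition bits_lt (x y : nat -> bool) : Prop :=
  sval (wochoice.well_ordering_principle (nat -> bool)) x y /\ x <> y.

Definition omega1 : Type :=
  {x : nat -> bool | countable [set y | bits_lt y x]}.

Definition olt (a b : omega1) : Prop := bits_lt (sval a) (sval b).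

Lemma bits_lt_wo : strict_order bits_lt /\ well_ordered bits_lt setT.
Proof.
rewrite /bits_lt; case: wochoice.well_ordering_principle => R /= Rwo.
have least B : B !=set0 ->
    exists2 b, B b & forall c : nat -> bool, B c -> is_true (R b c).
  move=> [x Bx]; have [|z [[Bz zB] _]] := Rwo (fun x => `[< B x >]).
    by exists x; apply/asboolP.
  by exists z; [apply/asboolP | move=> c Bc; apply: zB; apply/asboolP].
have Rxx x : R x x.
  by have [b -> /(_ x erefl)] := least [set x] (ex_intro _ x erefl).
have Ranti x y : R x y -> R y x -> x = y.
  move=> xy yx; have [|z [_ zP]] := Rwo (fun t => `[< t = x \/ t = y >]).
    by exists x; apply/asboolP; left.
  by rewrite -(zP x) ?(zP y) //; split; try (by apply/asboolP; auto);
     move=> t /asboolP[] ->.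
have Rtot x y : R x y \/ R y x.
  have [|b [] -> bP] := least [set t | t = x \/ t = y].
  - by exists x; left.
  - by left; apply: bP; right.
  - by right; apply: bP; left.
have Rtr x y z : R x y -> R y z -> R x z.
  move=> xy yz; have [|b] := least [set t | [\/ t = x, t = y | t = z]].
    by exists x; constructor 1.
  case=> -> bP.
  - by apply: bP; constructor 3.
  - by rewrite (Ranti x y) //; apply: bP; constructor 1.
  - by rewrite -(Ranti y z) //; apply: bP; constructor 2.
split; first split.
- by move=> x [].
- move=> x y z [xy nxy] [yz nyz]; split; first exact: Rtr xy yz.
  by move=> xz; apply: nxy; apply: Ranti => //; rewrite xz.
split.
- move=> x y _ _; have [->|/eqP nxy] := eqVneq x y; first by constructor 2.
  have [xy|yx] := Rtot x y; first by constructor 1.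
  by constructor 3; split=> // yx'; apply: nxy.
- move=> B _ /least[b Bb bP]; exists b => // c Bc.
  have [->|/eqP nbc] := eqVneq b c; first by left.
  by right; split=> //; apply: bP.
Qed.

Lemma omega1_val_inj (a b : omega1) : sval a = sval b -> a = b.
Proof.
case: a b => [x Ix] [y Iy] /= xy; rewrite xy in Ix *.
by congr exist; apply: Prop_irrelevance.
Qed.

Lemma omega1_wo : strict_order olt /\ well_ordered olt setT.
Proof.
have [[irr tr] [tot least]] := bits_lt_wo.
split; first by split=> [x|x y z]; [exact: irr | exact: tr].
split=> [x y _ _|B _ [b0 Bb0]].
  have [||xy|xy|xy] := tot (sval x) (sval y) => //.
  - by constructor 1.
  - by constructor 2; exact: omega1_val_inj.
  - by constructor 3.
have [||_ [b Bb <-] bP] := least (sval @` B) => //.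
  by exists (sval b0); exists b0.
exists b => // c Bc; have [|bc|bc] := bP (sval c); first by exists c.
  by left; exact: omega1_val_inj.
by right.
Qed.

Lemma omega1_countable_initial (a : omega1) : countable [set b | olt b a].
Proof.
have /countable_injP[f finj] := svalP a.
apply/countable_injP; exists (f \o sval) => b c.
rewrite !inE => ba ca /finj; rewrite !inE => /(_ ba ca); exact: omega1_val_inj.
Qed.

Lemma omega1_uncountable : ~ countable [set: omega1].
Proof.
move=> /countable_injP[f finj].
pose I := [set x : nat -> bool | countable [set y | bits_lt y x]].
have cI : countable I.
  apply/countable_injP.
  exists (fun x => if pselect (I x) is left Ix then f (exist _ x Ix) else 0).
  move=> x y; rewrite !inE => Ix Iy.
  case: pselect => // Ix'; case: pselect => // Iy' /finj.
  by rewrite !inE => /(_ Logic.I Logic.I) [].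
have [[irr tr] [tot least]] := bits_lt_wo.
have [allI|/existsNP[x0 nx0]] := pselect (forall x, I x).
  have /countable_injP[h hinj] := cI.
  pose d n := `[< exists2 x : nat -> bool, h x = n & ~~ x n >].
  have : d (h d) <-> ~~ d (h d).
    split=> [/asboolP[x /hinj]|nd]; last by apply/asboolP; exists d.
    by rewrite !inE => ->.
  by case: (d _) => -[]; auto => + /(_ isT).
have [//||m Im mP] := least (~` I); first by exists x0.
apply: Im; apply: sub_countable cI; apply: subset_card_le => y /= ym.
apply: contrapT => nIy; have [my|my] := mP y nIy.
  by rewrite my in ym; apply: irr ym.
exact: irr (tr _ _ _ my ym).
Qed.

Definition is_successor (a b : omega1) : Prop :=
  olt a b /\ forall c, olt a c -> ~ olt c b.

Definition is_limit (a : omega1) : Prop :=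
  (exists b, olt b a) /\ (forall b, ~ is_successor b a).

(* The set [A], ordered by [lt], has order type [a]. *)
Definition order_type (X : Type) (lt : X -> X -> Prop) (A : set X)
    (a : omega1) : Prop :=
  exists2 f : X -> omega1, set_bij A [set b | olt b a] f &
    forall x y, A x -> A y -> (lt x y <-> olt (f x) (f y)).

Definition predecessors (T : Type) (lt : T -> T -> Prop) (x : T) : set T :=
  [set y | lt y x].

Definition is_tree (T : Type) (lt : T -> T -> Prop) : Prop :=
  strict_order lt /\ forall x, well_ordered lt (predecessors lt x).

(* [has_height lt x a] : ht(x) is the countable ordinal [a]. *)
Definition has_height (T : Type) (lt : T -> T -> Prop) (x : T) (a : omega1) :
    Prop := order_type lt (predecessors lt x) a.

Definition level (T : Type) (lt : T -> T -> Prop) (a : omega1) : set T :=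
  [set x | has_height lt x a].

(* The height of a tree is the least ordinal at which the level is empty, so it
   is omega_1 iff all nodes have countable height and all countable ordinals
   are heights of nodes. *)
Definition omega1_tree (T : Type) (lt : T -> T -> Prop) : Prop :=
  [/\ is_tree lt,
      forall x, exists a, has_height lt x a,
      forall a, level lt a !=set0 &
      forall a, countable (level lt a)].

(* [a] is less than the height of the tree. *)
Definition below_height (T : Type) (lt : T -> T -> Prop) (a : omega1) : Prop :=
  level lt a !=set0.

Definition normal (T : Type) (lt : T -> T -> Prop) : Prop :=
  [/\ forall x a b, has_height lt x a -> is_successor a b ->
        below_height lt b ->
        exists y z, [/\ lt x y, lt x z & ~ comparable_in lt y z],
      forall x a, below_height lt a ->
        exists2 y, has_height lt y a & comparable_in lt x y &
      forall x y a, is_limit a -> has_height lt x a -> has_height lt y a ->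
        x <> y -> predecessors lt x <> predecessors lt y].

Definition chain (T : Type) (lt : T -> T -> Prop) (A : set T) : Prop :=
  forall x y, A x -> A y -> comparable_in lt x y.

Definition antichain (T : Type) (lt : T -> T -> Prop) (A : set T) : Prop :=
  forall x y, A x -> A y -> x <> y -> ~ comparable_in lt x y.

Definition suslin (T : Type) (lt : T -> T -> Prop) : Prop :=
  [/\ omega1_tree lt,
      ~ (exists2 A, chain lt A & ~ countable A) &
      ~ (exists2 A, antichain lt A & ~ countable A)].

Definition tree_power (T : Type) (lt : T -> T -> Prop) (m : nat) : Type :=
  {a : 'I_m -> T | exists h, forall i, has_height lt (a i) h}.

Definition power_lt (T : Type) (lt : T -> T -> Prop) (m : nat)
    (a b : tree_power lt m) : Prop := forall i, lt (sval a i) (sval b i).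

Definition derived (T : Type) (lt : T -> T -> Prop) (m : nat)
    (a : tree_power lt m) : Type :=
  {b : tree_power lt m | a = b \/ power_lt a b}.

Definition derived_lt (T : Type) (lt : T -> T -> Prop) (m : nat)
    (a : tree_power lt m) (b c : derived a) : Prop :=
  power_lt (sval b) (sval c).

Definition dim_free (T : Type) (lt : T -> T -> Prop) (m : nat) : Prop :=
  forall a : tree_power lt m, injective (sval a) -> suslin (@derived_lt T lt m a).

Definition free (T : Type) (lt : T -> T -> Prop) : Prop :=
  forall m, 1 <= m -> dim_free lt m.

(* [has_Delta lt x y d] : Delta(x, y) is the countable ordinal [d]. *)
Definition has_Delta (T : Type) (lt : T -> T -> Prop) (x y : T) (d : omega1) :
    Prop :=
  order_type lt [set z | (z = x \/ lt z x) /\ (z = y \/ lt z y)] d.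

(* As for entangled sets of reals, the tuples of the sequence are pairwise
   disjoint. Without this no tree with an injective m-tuple would be
   m-entangled for m >= 1: a constant sequence, or one that is constant in a
   single coordinate, has no xi < beta with a_{xi,i} < a_{beta,i} for all i. *)
Definition dim_entangled (T : Type) (lt : T -> T -> Prop) (m : nat) : Prop :=
  forall a : omega1 -> 'I_m -> T,
    (forall xi, injective (a xi)) ->
    (forall xi beta, xi <> beta -> forall i j, a xi i <> a beta j) ->
    (exists bound, forall xi (i j : 'I_m), i < j ->
       exists2 d, has_Delta lt (a xi i) (a xi j) d & olt d bound) ->
    forall g : 'I_m -> bool,
      exists xi beta, olt xi beta /\
        forall i, lt (a xi i) (a beta i) <-> g i = true.

Definition entangled (T : Type) (lt : T -> T -> Prop) : Prop :=
  forall m, 1 <= m -> dim_entangled lt m.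

(* Main.v *)
(** Entangled implies free: an uncountable antichain of a derived tree contains an
    omega_1-sequence of pairwise disjoint tuples, to which entangledness applies
    with g constantly 1. An uncountable chain projects to one of T.

    Free implies entangled: fix a level gamma above all the Delta's. Uncountably
    many of the tuples a_xi lie above the same tuple c of that level, which is
    injective; choose b_xi in the derived tree T_c with a_xi < b_xi. As T_c is
    Suslin, there is d in T_c above which the b_xi are dense, with uncountably
    many b_beta above every extension of d. Choose b_xi >= d, then e >= d whose
    i-th node extends a_(xi,i) or is incomparable with it, according to g(i), then
    b_beta >= e. *)

Require Import Defs.
From mathcomp Require Import all_boot.
From mathcomp Require Import boolp classical_sets functions cardinality.

Set Implicit Arguments.
Unset Strict Implicit.
Unset Printing Implicit Defensive.

Local Open Scope classical_set_scope.

(** * Countable sets *)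

Lemma countable_preimage (X Y : Type) (A : set X) (B : set Y) (f : X -> Y) :
  (forall x, A x -> B (f x)) ->
  (forall x y, A x -> A y -> f x = f y -> x = y) ->
  countable B -> countable A.
Proof.
move=> AB finj /countable_injP[h hinj]; apply/countable_injP.
exists (h \o f) => x y; rewrite !inE => Ax Ay /hinj; rewrite !inE => fxy.
by apply: finj => //; apply: fxy; apply: AB.
Qed.

Lemma countable_subset (X : Type) (A B : set X) :
  A `<=` B -> countable B -> countable A.
Proof. by move=> AB; apply: (@countable_preimage _ _ A B id). Qed.

Lemma countable_subsingleton (X : Type) (A : set X) :
  (forall x y, A x -> A y -> x = y) -> countable A.
Proof.
by move=> A1; apply/countable_injP; exists (fun=> 0) => x y; rewrite !inE; auto.
Qed.

Lemma countable_cover (I X : Type) (D : set I) (F : I -> set X) (A : set X) :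
  countable D -> (forall i, D i -> countable (F i)) ->
  (forall x, A x -> exists2 i, D i & F i x) -> countable A.
Proof.
move=> cD cF AF; apply: countable_subset (bigcup_countable cD cF) => x /AF.
by move=> [i Di Fix]; exists i.
Qed.

Lemma countable_countType (I : countType) : countable [set: I].
Proof.
by apply/countable_injP; exists pickle => x y _ _; apply: (pcan_inj pickleK).
Qed.

Lemma countable_or (X : Type) (P Q : set X) :
  countable P -> countable Q -> countable [set x | P x \/ Q x].
Proof.
move=> cP cQ; apply: (@countable_cover bool X setT (fun b => if b then P else Q)).
- exact: countable_countType.
- by case.
- by move=> x [Px|Qx]; [exists true | exists false].
Qed.

Lemma countable_tuples (T : Type) (n : nat) (D : set T) :
  countable D -> countable [set f : 'I_n -> T | forall i, D (f i)].
Proof.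
move=> /countable_injP[h hinj].
apply: (@countable_preimage _ (seq nat) _ setT
  (fun f => [seq h (f i) | i <- enum 'I_n])) => //.
move=> f f' Df Df' /eq_in_map ff'; apply: funext => i.
by apply: hinj; rewrite ?inE //; apply: ff'; rewrite mem_enum.
Qed.

Lemma uncountable_setD (X : Type) (A B : set X) :
  ~ countable A -> countable B -> exists2 x, A x & ~ B x.
Proof.
move=> ncA cB; apply: contrapT => nAB; apply: ncA.
apply: countable_subset cB => x Ax; apply: contrapT => nBx.
by apply: nAB; exists x.
Qed.

(** * Countable ordinals *)

Lemma olt_irr (a : omega1) : ~ olt a a.
Proof. by have [[h _] _] := omega1_wo; apply: h. Qed.

Lemma olt_trans (a b c : omega1) : olt a b -> olt b c -> olt a c.
Proof. by have [[_ h] _] := omega1_wo; apply: h. Qed.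

Lemma olt_total (a b : omega1) : comparable_in olt a b.
Proof. by have [_ [h _]] := omega1_wo; apply: h. Qed.

Lemma olt_least (B : set omega1) : B !=set0 ->
  exists2 b, B b & forall c, olt c b -> ~ B c.
Proof.
move=> B0; have [_ [_ h]] := omega1_wo; have [//|b Bb bP] := h B _ B0.
exists b => // c cb /bP[bc|bc]; first by rewrite bc in cb; apply: olt_irr cb.
exact: olt_irr (olt_trans cb bc).
Qed.

Lemma olt_not_gt (a b : omega1) : ~ olt a b -> b = a \/ olt b a.
Proof. by case: (olt_total a b) => //; auto. Qed.

Lemma olt_wf : well_founded olt.
Proof.
move=> a; apply: contrapT => na.
have [|b nb bP] := @olt_least (fun x => ~ Acc olt x); first by exists a.
by apply: nb; constructor => c /bP /contrapT.
Qed.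

(** Regularity of $\omega_1$: the closed initial segments of the points of [D] have a countable
    union, and any point outside it is a bound. *)
Lemma omega1_countable_bound (D : set omega1) :
  countable D -> exists b, forall a, D a -> olt a b.
Proof.
move=> cD.
have cU : countable (\bigcup_(a in D) [set x | x = a \/ olt x a]).
  apply: bigcup_countable => // a _; apply: countable_or => //.
    exact: countable1.
  exact: omega1_countable_initial.
have [b _ bP] := uncountable_setD omega1_uncountable cU.
exists b => a Da; case: (olt_total a b) => // [ab|ba]; case: bP; exists a => //.
  by left.
by right.
Qed.

Lemma omega1_successor (a : omega1) : exists b, is_successor a b.
Proof.
have [b ab] := omega1_countable_bound (countable1 a).
have [|c ac cP] := @olt_least (olt a); first by exists b; apply: ab.
by exists c; split=> // d ad /cP.
Qed.

(** Transfinite recursion in which [s xi] depends only on the set of earlier values at indices in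
    [D]. That set is countable, so [P C] need only be satisfiable for countable [C]. *)
Lemma omega1_recursive_choice (X : Type) (D : set omega1) (P : set X -> X -> Prop) :
  (forall C, countable C -> exists x, P C x) ->
  exists s : omega1 -> X,
    forall xi, P (s @` [set eta | D eta /\ olt eta xi]) (s xi).
Proof.
move=> exP.
(* [ch] is total: on uncountable sets it takes a junk value, which exists by [exP set0]. *)
have /choice[ch chP] (C : set X) : exists x, countable C -> P C x.
  have [/exP[x Px]|nC] := pselect (countable C); first by exists x.
  by have [x _] := exP set0 (countable0 X); exists x.
pose F xi (r : forall eta, olt eta xi -> X) :=
  ch [set x | exists eta (h : olt eta xi), D eta /\ x = r eta h].
exists (Fix olt_wf (fun=> X) F) => xi; rewrite [X in P _ X]Fix_eq; last first.
  move=> x f g fg; rewrite /F; congr ch; apply: funext => y.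
  by apply: propext; split=> -[eta [h [De ->]]]; exists eta, h; rewrite fg.
rewrite /F; set s := Fix _ _ _; set C := (X in ch X).
have -> : s @` [set eta | D eta /\ olt eta xi] = C.
  apply: funext => y; apply: propext; split.
    by move=> [eta [De h] <-]; exists eta, h.
  by move=> [eta [h [De ->]]]; exists eta.
apply: chP.
apply: (@countable_cover omega1 X [set eta | olt eta xi] (fun eta => [set s eta])).
- exact: omega1_countable_initial.
- by move=> eta _; apply: countable1.
- by move=> x [eta [h [_ ->]]]; exists eta.
Qed.

(** * Comparison of order types *)

(** At the least [y] with [f y] below [y], monotonicity puts [f (f y)] below [f y], a smaller
    counterexample. *)
Lemma strictly_increasing_ge (a : omega1) (f : omega1 -> omega1) :
  (forall x y, olt x a -> olt y a -> olt x y -> olt (f x) (f y)) ->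
  (forall x, olt x a -> olt (f x) a) -> forall x, olt x a -> ~ olt (f x) x.
Proof.
move=> fi fa x xa fx.
have [|y [ya fy] yP] := @olt_least [set y | olt y a /\ olt (f y) y].
  by exists x.
by apply: (yP _ fy); split; [exact: fa | apply: fi => //; exact: fa].
Qed.

(** Were [b] below [a], the inverse of the collapse of [A] followed by the collapse of [B] would be
    an increasing self-map of [a] sending [b] below itself. *)
Lemma order_type_sub (X : Type) (lt : X -> X -> Prop) (A B : set X)
    (a b : omega1) :
  order_type lt A a -> order_type lt B b -> A `<=` B -> ~ olt b a.
Proof.
move=> [f [fA finj fsurj] fmono] [g [gB ginj gsurj] gmono] AB ba.
have /choice[k kP] (x : omega1) : exists y, olt x a -> A y /\ f y = x.
  have [xa|nxa] := pselect (olt x a); last first.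
    by have [y _ _] := fsurj _ ba; exists y.
  by have [y Ay fy] := fsurj _ xa; exists y.
apply: (@strictly_increasing_ge a (g \o k) _ _ b ba) => /=.
- move=> x y xa ya xy; have [Akx fkx] := kP _ xa; have [Aky fky] := kP _ ya.
  by rewrite -gmono; [rewrite fmono // fkx fky | exact: AB..].
- by move=> x xa; have [/AB/gB/= h _] := kP _ xa; exact: olt_trans h ba.
- by have [/AB/gB/= h _] := kP _ ba.
Qed.

(** The collapse [f] of [B] maps [A] onto an initial segment, so [d] is the least ordinal missed by
    [f] on [A]; it is at most [a] because [a] is missed. *)
Lemma order_type_downward_closed (X : Type) (lt : X -> X -> Prop) (A B : set X)
    (a : omega1) :
  order_type lt B a -> A `<=` B -> (forall x y, A x -> B y -> lt y x -> A y) ->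
  exists2 d, order_type lt A d & ~ olt a d.
Proof.
move=> [f [fB finj fsurj] fmono] AB down.
have na : ~ (f @` A) a by move=> [x /AB/fB /= + fx]; rewrite fx; exact: olt_irr.
have [|d nd dP] := @olt_least (~` (f @` A)); first by exists a.
exists d; last by move=> ad; case: (dP _ ad na).
exists f; last by move=> x y /AB Bx /AB By; exact: fmono.
split.
- move=> x Ax /=; case: (olt_total (f x) d) => // [fx|dx].
    by case: nd; exists x.
  have [y By fy] := fsurj d (olt_trans dx (fB _ (AB _ Ax))).
  case: nd; exists y => //; apply: (down _ _ Ax By).
  by apply/(fmono _ _ By (AB _ Ax)); rewrite fy.
- by move=> x y; rewrite !inE => /AB Bx /AB By; apply: finj; rewrite inE.
- by move=> b /dP /contrapT.
Qed.

Lemma order_type_unique (X : Type) (lt : X -> X -> Prop) (A : set X)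
    (a b : omega1) :
  order_type lt A a -> order_type lt A b -> a = b.
Proof.
move=> Aa Ab; case: (olt_total a b) => // h; exfalso.
  exact: order_type_sub Ab Aa _ h.
exact: order_type_sub Aa Ab _ h.
Qed.

(* The transitive collapse of a set [A] of countable ordinals. *)
Lemma omega1_collapse (A : set omega1) : exists col : omega1 -> omega1,
  (forall x y, A x -> olt x y -> olt (col x) (col y)) /\
  (forall x b, olt b (col x) -> exists y, [/\ A y, olt y x & col y = b]).
Proof.
(* [col x] is the least ordinal not taken at a point of [A] before [x], that is, the order type of
   [A] below [x]. *)
have [|col colP] := @omega1_recursive_choice omega1 A
  (fun C x => ~ C x /\ forall c, olt c x -> C c).
  move=> C cC; have [x _ nCx] := uncountable_setD omega1_uncountable cC.
  have [|b nCb bP] := @olt_least (~` C); first by exists x.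
  by exists b; split=> // c /bP/contrapT.
exists col; split=> [x y Ax xy|x b bx].
  have [nCx _] := colP x; have [nCy yP] := colP y.
  case: (olt_total (col x) (col y)) => // [e|yx]; first by case: nCy; exists x.
  have [_ /(_ _ yx)[z [Az zx] zy]] := colP x.
  by case: nCy; exists z => //; split=> //; exact: olt_trans zx xy.
have [_ /(_ _ bx)[y [Ay yx] <-]] := colP x; by exists y.
Qed.

(** * Heights and derived trees *)

Definition tle (T : Type) (lt : T -> T -> Prop) (x y : T) : Prop :=
  x = y \/ lt x y.

Lemma tle_lt_trans (T : Type) (lt : T -> T -> Prop) (x y z : T) :
  strict_order lt -> tle lt x y -> lt y z -> lt x z.
Proof. by move=> [_ tr] [->//|xy] yz; exact: tr xy yz. Qed.

Lemma lt_tle_trans (T : Type) (lt : T -> T -> Prop) (x y z : T) :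
  strict_order lt -> lt x y -> tle lt y z -> lt x z.
Proof. by move=> [_ tr] xy [<-//|yz]; exact: tr xy yz. Qed.

Lemma tle_trans (T : Type) (lt : T -> T -> Prop) (x y z : T) :
  strict_order lt -> tle lt x y -> tle lt y z -> tle lt x z.
Proof. by move=> so xy [<-//|yz]; right; exact: tle_lt_trans xy yz. Qed.

Lemma tree_comparable (T : Type) (lt : T -> T -> Prop) (x y z : T) :
  is_tree lt -> tle lt x z -> tle lt y z -> comparable_in lt x y.
Proof.
move=> [so wo] [->|xz] [->|yz]; try by [constructor 2 | constructor 3 | constructor 1].
by have [h _] := wo z; apply: h.
Qed.

(** A collapse of the predecessors of [y] restricts to one of the predecessors of each [x] below
    [y], so a single map gives all heights below [y]. *)
Lemma has_height_pred (T : Type) (lt : T -> T -> Prop) (y : T) (b : omega1) :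
  is_tree lt -> has_height lt y b ->
  exists2 f : T -> omega1, set_bij (predecessors lt y) [set c | olt c b] f &
    forall x, lt x y -> has_height lt x (f x).
Proof.
move=> [[_ tr] wo] [f [fA finj fsurj] fmono]; exists f => // x xy.
have sub z : lt z x -> lt z y by move=> zx; exact: tr zx xy.
exists f; last by move=> u v /sub ux /sub vx; exact: fmono.
split.
- by move=> z zx /=; rewrite -fmono //; exact: sub.
- by move=> u v; rewrite !inE => /sub ux /sub vx; apply: finj; rewrite inE.
- move=> c cx; have [|z zy fz] := fsurj c; first exact: olt_trans cx (fA _ xy).
  by exists z => //; apply/fmono => //; rewrite fz.
Qed.

Lemma has_height_lt (T : Type) (lt : T -> T -> Prop) (x y : T) (a b : omega1) :
  is_tree lt -> has_height lt x a -> has_height lt y b -> lt x y -> olt a b.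
Proof.
move=> tT xa yb xy; have [f [fA _ _] fP] := has_height_pred tT yb.
by rewrite (order_type_unique xa (fP _ xy)); exact: fA.
Qed.

Lemma has_height_below (T : Type) (lt : T -> T -> Prop) (y : T) (a b : omega1) :
  is_tree lt -> has_height lt y b -> olt a b ->
  exists2 x, lt x y & has_height lt x a.
Proof.
move=> tT yb ab; have [f [_ _ fsurj] fP] := has_height_pred tT yb.
by have [x xy <-] := fsurj _ ab; exists x => //; exact: fP.
Qed.

Lemma height_eq_below (T : Type) (lt : T -> T -> Prop) (x y z : T) (a : omega1) :
  is_tree lt -> has_height lt x a -> has_height lt y a ->
  tle lt x z -> tle lt y z -> x = y.
Proof.
move=> tT xa ya xz yz; case: (tree_comparable tT xz yz) => // xy; exfalso.
  exact: olt_irr (has_height_lt tT xa ya xy).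
exact: olt_irr (has_height_lt tT ya xa xy).
Qed.

Lemma height_lt_below (T : Type) (lt : T -> T -> Prop) (x y z : T) (a b : omega1) :
  is_tree lt -> has_height lt x a -> has_height lt y b -> olt a b ->
  tle lt x z -> tle lt y z -> lt x y.
Proof.
move=> tT xa yb ab xz yz; case: (tree_comparable tT xz yz) => // [xy|yx].
  by rewrite xy in xa; case: (@olt_irr a); rewrite {2}(order_type_unique xa yb).
by case: (@olt_irr a); exact: olt_trans ab (has_height_lt tT yb xa yx).
Qed.

Lemma normal_extend (T : Type) (lt : T -> T -> Prop) (x : T) (a b : omega1) :
  omega1_tree lt -> normal lt -> has_height lt x a -> olt a b ->
  exists2 y, lt x y & has_height lt y b.
Proof.
move=> [tT _ nonempty _] [_ ext _] xa ab.
have [y yb xy] := ext x b (nonempty b); exists y => //.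
case: xy => // [xy|yx].
  by rewrite xy in xa; case: (@olt_irr a); rewrite {2}(order_type_unique xa yb).
by case: (@olt_irr a); exact: olt_trans ab (has_height_lt tT yb xa yx).
Qed.

(** The entries of [e] may have different heights; a bound on these finitely many ordinals gives a
    common level to extend them to. *)
Lemma tuple_extend (T : Type) (lt : T -> T -> Prop) (n : nat) (e : 'I_n -> T) :
  omega1_tree lt -> normal lt ->
  exists e' : tree_power lt n, forall i, lt (e i) (sval e' i).
Proof.
move=> oT nT; have [tT hasht _ _] := oT.
have [h hP] := choice hasht.
have [|b bP] := @omega1_countable_bound (range (h \o e)).
  apply: (@countable_cover 'I_n _ setT (fun i => [set h (e i)])).
  - exact: (countable_countType 'I_n).
  - by move=> i _; apply: countable1.
  - by move=> _ [i _ <-]; exists i.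
have /choice[e' e'P] (i : 'I_n) : exists y, lt (e i) y /\ has_height lt y b.
  have [|y ey yb] := normal_extend oT nT (hP (e i)) (b := b).
    by apply: bP; exists i.
  by exists y.
have e'b : exists h, forall i, has_height lt (e' i) h.
  by exists b => i; have [] := e'P i.
by exists (exist _ e' e'b) => i; have [] := e'P i.
Qed.

(** The nodes of the derived tree sit on the levels of [T] from that of [c] upwards; collapsing this
    set of levels onto $\omega_1$ turns levels of [T] into derived heights. *)
Lemma derived_omega1_tree (T : Type) (lt : T -> T -> Prop) (n : nat)
    (c : tree_power lt n) : 0 < n ->
  omega1_tree lt -> normal lt -> omega1_tree (@derived_lt T lt n c).
Proof.
move=> n0 oT nT; have [tT hasht nonempty ctb] := oT.
have [[irr tr] _] := tT; pose i0 : 'I_n := Ordinal n0.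
have [H HP] : {H : tree_power lt n -> omega1 &
    forall b i, has_height lt (sval b i) (H b)}.
  by apply: (@choice _ _ (fun b h => forall i, has_height lt (sval b i) h)) => -[].
have H_uniq (b : tree_power lt n) h : has_height lt (sval b i0) h -> H b = h.
  by move=> bh; exact: order_type_unique (HP b i0) bh.
have ext_eq (b b' : derived c) :
    (forall i, sval (sval b) i = sval (sval b') i) -> b = b'.
  case: b b' => -[b pb] qb [[b' pb'] qb'] /= bb'.
  by apply: eq_exist; apply: eq_exist; apply: funext.
pose Hd (b : derived c) := H (sval b).
have Hd_lt b b' : derived_lt b b' -> olt (Hd b) (Hd b').
  by move=> /(_ i0); apply: has_height_lt => //; exact: HP.
have below_eq b b' e : derived_lt b e -> derived_lt b' e -> Hd b = Hd b' -> b = b'.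
  move=> be b'e hb; apply: ext_eq => i.
  apply: (@height_eq_below _ lt _ _ (sval (sval e) i) (Hd b)) => //.
  - by rewrite hb; exact: HP.
  - by right; apply: be.
  - by right; apply: b'e.
have below_lt b b' e : derived_lt b e -> derived_lt b' e -> olt (Hd b) (Hd b') ->
    derived_lt b b'.
  move=> be b'e hb i.
  apply: (@height_lt_below _ lt _ _ (sval (sval e) i) (Hd b) (Hd b')) => //.
  - by right; apply: be.
  - by right; apply: b'e.
pose A : set omega1 := [set h | h = H c \/ olt (H c) h].
have AHd b : A (Hd b).
  rewrite /Hd; case: (svalP b) => [<-|cb]; first by left.
  by right; apply: has_height_lt (cb i0) => //; exact: HP.
have [col [col_lt col_onto]] := omega1_collapse A.
have col_inj h h' : A h -> A h' -> col h = col h' -> h = h'.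
  move=> Ah Ah' hh; case: (olt_total h h') => // lhh; case: (@olt_irr (col h)).
    by rewrite {2}hh; exact: col_lt.
  by rewrite {1}hh; exact: col_lt.
have derived_tree : is_tree (@derived_lt T lt n c).
  split; first split.
  - by move=> b /(_ i0); exact: irr.
  - by move=> x y z xy yz i; exact: tr (xy i) (yz i).
  move=> e; split=> [b b' be b'e|B Be [b0 Bb0]].
    case: (olt_total (Hd b) (Hd b')) => h.
    - by constructor 1; exact: below_lt h.
    - by constructor 2; exact: below_eq h.
    - by constructor 3; exact: below_lt h.
  have [|h [b Bb <-] hP] := @olt_least (Hd @` B); first by exists (Hd b0); exists b0.
  exists b => // b' Bb'; have := hP (Hd b').
  case: (olt_total (Hd b) (Hd b')) => hb hb'.
  - by right; apply: below_lt hb; exact: Be.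
  - by left; apply: below_eq hb; exact: Be.
  - by case: (hb' hb); exists b'.
have derived_height b : has_height (@derived_lt T lt n c) b (col (Hd b)).
  exists (col \o Hd); last first.
    move=> x y xb yb; split=> /= [/Hd_lt|]; first exact: col_lt.
    case: (olt_total (Hd x) (Hd y)) => [xy _|->/olt_irr//|yx xy].
      exact: below_lt xy.
    by case: (@olt_irr (col (Hd x))); exact: olt_trans xy (col_lt _ _ _ yx).
  split.
  - by move=> x /Hd_lt /=; exact: col_lt.
  - move=> x y; rewrite !inE => xb yb /= /col_inj xy.
    by apply: (below_eq _ _ b) => //; exact: xy.
  (* Surjectivity: the node sought is the restriction of [b] to level [k], which is [c] itself if
     [k] is [H c]. *)
  move=> h /col_onto[k [Ak kb <-]].
  have cb : power_lt c (sval b).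
    case: (svalP b) => // cb; case: Ak kb => [->|ck]; rewrite /Hd -cb => kb.
      by case: (olt_irr kb).
    by case: (olt_irr (olt_trans ck kb)).
  case: Ak => [->|ck]; first by exists (exist _ c (or_introl erefl)).
  have /choice[e eP] i : exists x, lt x (sval (sval b) i) /\ has_height lt x k.
    by have [x xb xk] := has_height_below tT (HP (sval b) i) kb; exists x.
  have ek : exists h, forall i, has_height lt (e i) h.
    by exists k => i; have [] := eP i.
  pose e' : tree_power lt n := exist _ e ek.
  have ce : power_lt c e'.
    move=> i; have [eb e_k] := eP i.
    apply: (height_lt_below (z := sval (sval b) i) tT (HP c i) e_k) => //.
      by right; apply: cb.
    by right.
  exists (exist _ e' (or_intror ce)); first by move=> i; have [] := eP i.
  by congr col; apply: H_uniq; have [] := eP i0.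
split=> //.
- by move=> b; exists (col (Hd b)).
- move=> a.
  (* A missed [a] would bound [col] on [A], so [A] would inject into an initial segment; with the
     countably many ordinals below [H c] this would exhaust [omega1]. *)
  have [h Ah <-] : exists2 h, A h & col h = a.
    apply: contrapT => na; apply: omega1_uncountable.
    have cA : countable A.
      apply: (@countable_preimage _ _ _ [set b | olt b a] col) => //.
        move=> h Ah; case: (olt_total (col h) a) => // [ha|/col_onto].
          by case: na; exists h.
        by move=> [y [Ay _ ya]]; case: na; exists y.
      exact: omega1_countable_initial.
    have := countable_or cA (omega1_countable_initial (H c)).
    apply: countable_subset => h _.
    by case: (olt_total h (H c)) => h'; [right | left; left | left; right].
  have [b <-] : exists b, Hd b = h.
    case: Ah => [->|ch]; first by exists (exist _ c (or_introl erefl)).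
    have /choice[e eP] i : exists y, lt (sval c i) y /\ has_height lt y h.
      by have [y cy yh] := normal_extend oT nT (HP c i) ch; exists y.
    have eh : exists h, forall i, has_height lt (e i) h.
      by exists h => i; have [] := eP i.
    pose e' : tree_power lt n := exist _ e eh.
    have ce : power_lt c e' by move=> i; have [] := eP i.
    by exists (exist _ e' (or_intror ce)); apply: H_uniq; have [] := eP i0.
  by exists b; exact: derived_height.
- move=> a; have [[b0 b0a]|na] := pselect (level (@derived_lt T lt n c) a !=set0); last first.
    by apply: countable_subsingleton => x y xa; case: na; exists x.
  (* A derived level lies on a single level of [T], so its nodes are tuples from a countable set. *)
  have Ha b : level (@derived_lt T lt n c) a b -> Hd b = Hd b0.
    move=> ba; apply: col_inj => //.
    rewrite (order_type_unique (derived_height b) ba).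
    exact: order_type_unique b0a (derived_height b0).
  apply: (countable_preimage (f := fun b : derived c => sval (sval b))
    _ _ (countable_tuples n (ctb (Hd b0)))).
  + by move=> b /Ha <- i; exact: HP.
  + by move=> b b' _ _ bb'; apply: ext_eq => i; rewrite bb'.
Qed.

Lemma countable_predecessors (T : Type) (lt : T -> T -> Prop) (x : T) :
  omega1_tree lt -> countable [set y | tle lt y x].
Proof.
move=> [_ hasht _ _]; apply: countable_or; first exact: countable1.
have [a [f [fA finj _] _]] := hasht x.
apply: (countable_preimage (f := f) _ _ (omega1_countable_initial a)) => //.
by move=> u v ux vx; apply: finj; rewrite inE.
Qed.

(** * Entangledness implies freeness *)

Lemma entangled_free (T : Type) (lt : T -> T -> Prop) (n : nat) :
  0 < n -> suslin lt -> normal lt -> dim_entangled lt n -> dim_free lt n.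
Proof.
move=> n0 [oT nochain _] nT ent c cinj; pose i0 : 'I_n := Ordinal n0.
have [tT _ _ ctb] := oT; have [so _] := tT; have [irr tr] := so.
have [h hc] := svalP c.
have above (b : derived c) i : tle lt (sval c i) (sval (sval b) i).
  by case: (svalP b) => [<-|cb]; [left | right].
split; first exact: derived_omega1_tree.
- case=> A chA ncA; apply: nochain.
  exists ((fun b => sval (sval b) i0) @` A).
    move=> _ _ [b Ab <-] [b' Ab' <-].
    case: (chA b b' Ab Ab') => [bb'|->|bb'].
    + by constructor 1; apply: bb'.
    + by constructor 2.
    + by constructor 3; apply: bb'.
  (* The projection is injective on a chain: comparable nodes with the same entry at [i0]
     coincide. *)
  move=> cA; apply: ncA; apply: countable_preimage cA; first by move=> b Ab; exists b.
  move=> b b' Ab Ab' /= bb'; case: (chA b b' Ab Ab') => // /(_ i0).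
    by rewrite bb' => /irr.
  by rewrite bb' => /irr.
- case=> A aA ncA.
  (* Sharing an entry, possibly in different positions, forces equal heights, so a tuple meets only
     countably many others. *)
  pose meet (b b' : derived c) := exists i j, sval (sval b) i = sval (sval b') j.
  have cmeet b : countable (meet b).
    have [k bk] := svalP (sval b).
    apply: (countable_preimage (f := fun b' : derived c => sval (sval b'))
      _ _ (countable_tuples n (ctb k))).
      move=> b' [i [j bb']] l; have [k' b'k] := svalP (sval b').
      have -> : k = k'; last exact: b'k.
      by apply: order_type_unique (b'k j); rewrite -bb'; exact: bk.
    by move=> [[x px] qx] [[y py] qy] _ _ /= xy; do 2 apply: eq_exist.
  (* Each [s xi] is a member of the antichain meeting no earlier one; a countable [C] rules out only
     countably many members. *)
  have [|s sP] := @omega1_recursive_choice (derived c) setT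
    (fun C b => A b /\ forall b', C b' -> ~ meet b' b).
    move=> C cC.
    have [b Ab bC] := uncountable_setD ncA (bigcup_countable cC (fun b _ => cmeet b)).
    by exists b; split=> // b' Cb' b'b; apply: bC; exists b'.
  have sdisj xi beta : olt xi beta -> ~ meet (s xi) (s beta).
    by move=> xb; have [_] := sP beta; apply; exists xi.
  have [| | |xi [beta [xb lt_xb]]] :=
    ent (fun xi => sval (sval (s xi))) _ _ _ (fun=> true).
  (* A repeated entry would lie above two entries of [c] on one level, which then coincide. *)
  + move=> xi i j sij; apply: cinj.
    apply: height_eq_below (hc i) (hc j) (above (s xi) i) _ => //.
    by rewrite sij; exact: above.
  + move=> xi beta; case: (olt_total xi beta) => // [xb|bx] _ i j sij.
      by apply: (sdisj _ _ xb); exists i, j.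
    by apply: (sdisj _ _ bx); exists j, i.
  (* The nodes common to two entries lie strictly below an entry of [c], which has height [h]. So
     every Delta is at most [h], and the successor of [h] is a strict bound. *)
  + have [b hb] := omega1_successor h; exists b => xi i j ij.
    have Dc : [set z | tle lt z (sval (sval (s xi)) i) /\
        tle lt z (sval (sval (s xi)) j)] `<=` predecessors lt (sval c i).
      move=> z [zi zj]; case: (tree_comparable tT zi (above (s xi) i)) => // cz.
        have cij : sval c i = sval c j.
          by apply: height_eq_below (hc i) (hc j) _ (above (s xi) j); rewrite // -cz.
        by move: ij; rewrite (cinj _ _ cij) ltnn.
      have cij : sval c i = sval c j.
        apply: height_eq_below (hc i) (hc j) _ (above (s xi) j) => //.
        by apply: tle_trans (or_intror cz) zj.
      by move: ij; rewrite (cinj _ _ cij) ltnn.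
    have [| d Dd dh] := order_type_downward_closed (hc i) Dc.
      move=> x y [xi1 xj1] _ yx.
      by split; right; [exact: lt_tle_trans yx xi1 | exact: lt_tle_trans yx xj1].
    exists d => //; have [hb' _] := hb.
    by case: (olt_not_gt dh) => [->|/olt_trans]; last exact.
  (* With [g] constantly true the two tuples are comparable in the derived tree; they are distinct
     since they share no entry. *)
  + have [[Ax _] [Ab _]] := (sP xi, sP beta).
    apply: (aA _ _ Ax Ab).
      by move=> sxb; apply: (sdisj _ _ xb); exists i0, i0; rewrite sxb.
    by constructor 1 => i; apply/lt_xb.
Qed.

(** * Freeness implies entangledness *)

(* Otherwise the nodes below only countably many members of the family are dense.
   The minimal such nodes form a countable antichain, and every member of the
   family is comparable with one of them, so the family would be countable. *)
Lemma suslin_somewhere_dense (T : Type) (lt : T -> T -> Prop) (I : Type)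
    (S : set I) (b : I -> T) :
  suslin lt -> ~ countable S ->
  (forall x, countable [set xi | S xi /\ tle lt (b xi) x]) ->
  exists d, forall e, tle lt d e ->
    ~ countable [set xi | S xi /\ tle lt e (b xi)].
Proof.
move=> [[tT _ _ _] _ noanti] ncS cb; have [so wo] := tT; have [irr tr] := so.
apply: contrapT => nod; apply: ncS.
pose few : set T := [set e | countable [set xi | S xi /\ tle lt e (b xi)]].
have few_dense d : exists2 e, tle lt d e & few e.
  apply: contrapT => nd; apply: nod; exists d => e de ce.
  by apply: nd; exists e.
pose M : set T := [set e | few e /\ forall e', lt e' e -> ~ few e'].
have cM : countable M.
  apply: contrapT => ncM; apply: noanti; exists M => //.
  by move=> x y [fx xP] [fy yP] nxy [/yP||/xP].
have few_min e : few e -> exists2 e0, M e0 & tle lt e0 e.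
  move=> fe; have [[e1 e1e fe1]|ne] := pselect (exists2 e1, lt e1 e & few e1).
    have [_ least] := wo e.
    have [| |e0 [e0e fe0] e0P] := least [set x | lt x e /\ few x].
    - by move=> x [].
    - by exists e1.
    exists e0; last by right.
    split=> // e' e'e0 fe'.
    have [|e0e'|e0e'] := e0P e'; first by split=> //; exact: tr e'e0 e0e.
      by rewrite e0e' in e'e0; exact: irr e'e0.
    exact: irr (tr _ _ _ e'e0 e0e').
  exists e; last by left.
  by split=> // e' e'e fe'; apply: ne; exists e'.
apply: (countable_cover cM (F := fun e => [set xi |
    (S xi /\ tle lt e (b xi)) \/ (S xi /\ tle lt (b xi) e)])).
  by move=> e [ce _]; apply: countable_or (cb e).
(* [b xi] and [e0] both lie at or below [e], hence are comparable. *)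
move=> xi Sxi; have [e be fe] := few_dense (b xi).
have [e0 Me0 e0e] := few_min e fe; exists e0 => //=.
case: (tree_comparable tT be e0e) => h; [right|left|left]; split=> //.
- by right.
- by left.
- by right.
Qed.

Lemma free_entangled (T : Type) (lt : T -> T -> Prop) (n : nat) :
  0 < n -> omega1_tree lt -> normal lt -> dim_free lt n -> dim_entangled lt n.
Proof.
move=> n0 oT nT fr a _ adisj [bd bdP] g; pose i0 : 'I_n := Ordinal n0.
have [tT hasht nonempty ctb] := oT; have [so _] := tT; have [_ tr] := so.
have [split_above ext _] := nT.
(* By disjointness a node is an entry of at most one tuple, so a countable set of nodes can be
   avoided at the cost of countably many indices. *)
have hits D : countable D -> countable [set xi | exists i, D (a xi i)].
  move=> cD; apply: (countable_cover cD (F := fun x => [set xi | exists i, a xi i = x])).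
    move=> x _; apply: countable_subsingleton => xi beta [i aix] [j ajx].
    by apply: contrapT => /adisj/(_ i j); rewrite aix ajx.
  by move=> xi [i Di]; exists (a xi i) => //; exists i.
have clow : countable [set x | exists2 y, level lt bd y & lt x y].
  apply: (countable_cover (ctb bd) (F := fun y => [set x | tle lt x y])).
    by move=> y _; exact: countable_predecessors.
  by move=> x [y yb xy]; exists y => //; right.
(* Pigeonhole: level [bd] carries only countably many tuples, and only countably many [a xi] have an
   entry below a node of that level. *)
have [c cb ncS] : exists2 c : 'I_n -> T, (forall i, level lt bd (c i)) &
    ~ countable [set xi | forall i, tle lt (c i) (a xi i)].
  apply: contrapT => nc; apply: omega1_uncountable.
  apply: (countable_cover (countable_tuples n (ctb bd)) (F := fun c => [set xi |
    (exists i, exists2 y, level lt bd y & lt (a xi i) y) \/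
    (forall i, tle lt (c i) (a xi i))])).
    move=> c cb; apply: countable_or (hits _ clow) _.
    by apply: contrapT => ncc; apply: nc; exists c.
  move=> xi _.
  have /choice[r rP] i : exists y, has_height lt y bd /\ comparable_in lt (a xi i) y.
    by have [y yb ay] := ext (a xi i) bd (nonempty bd); exists y.
  exists r; first by move=> i; have [] := rP i.
  have [low|nlow] := pselect (exists i, exists2 y, level lt bd y & lt (a xi i) y).
    by left.
  right=> i; have [rb] := rP i; case=> [ar|->|ra]; [|by left|by right].
  by case: nlow; exists i, (r i).
have cinj : injective c.
  have [xi Sxi _] := uncountable_setD ncS (countable0 _).
  (* If [c i] and [c j] agreed, their predecessors, of order type [bd], would lie below both
     [a xi i] and [a xi j], whose Delta would then not be below [bd]. *)
  have cneq (i j : 'I_n) : i < j -> c i <> c j.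
    move=> /(bdP xi)[d ad dbd] cij.
    apply: order_type_sub (cb i) ad _ dbd => z zc.
    split; right; first exact: (lt_tle_trans so zc (Sxi i)).
    by rewrite cij in zc; exact: (lt_tle_trans so zc (Sxi j)).
  move=> i j cij; apply: val_inj; case: (ltngtP i j) => // [/cneq|/cneq]; first by [].
  by rewrite cij.
have c_height : exists h, forall i, has_height lt (c i) h by exists bd.
pose c' : tree_power lt n := exist _ c c_height.
have c'_suslin := fr c' cinj; have [[dT _ _ _] _ _] := c'_suslin.
have derive (x : 'I_n -> T) : (forall i, tle lt (c i) (x i)) ->
    exists e : derived c', forall i, lt (x i) (sval (sval e) i).
  move=> cx; have [e xe] := tuple_extend x oT nT.
  have ce : power_lt c' e by move=> i; exact: tle_lt_trans (cx i) (xe i).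
  by exists (exist _ e (or_intror ce)).
have above (e : derived c') i : tle lt (c i) (sval (sval e) i).
  by case: (svalP e) => [<-|ce]; [left | right].
have dle (e e' : derived c') i : tle (@derived_lt T lt n c') e e' ->
    tle lt (sval (sval e) i) (sval (sval e') i).
  by case=> [->|ee']; [left | right].
pose S : set omega1 := [set xi | forall i, tle lt (c i) (a xi i)].
(* Outside [S] the value of [b] is an arbitrary node of the derived tree. *)
have /choice[b bP] xi : exists e : derived c',
    S xi -> forall i, lt (a xi i) (sval (sval e) i).
  have [Sxi|nS] := pselect (S xi).
    by have [e ae] := derive _ Sxi; exists e.
  by have [e _] := derive c (fun i => or_introl erefl); exists e.
have [|d dP] := suslin_somewhere_dense c'_suslin (b := b) ncS.
  (* If [b xi] is at or below [e], then [a xi i0] lies below an entry of [e], which happens for only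
     countably many [xi]. *)
  move=> e; apply: countable_subset (hits _ (countable_predecessors (sval (sval e) i0) oT)).
  move=> xi [Sxi be]; exists i0 => /=; right.
  exact: lt_tle_trans (bP _ Sxi i0) (dle _ _ i0 be).
(* A pair of splitting nodes above each entry of [d], for the coordinates where [g] is false. *)
have /choice[p pP] i : exists p : T * T, [/\ lt (sval (sval d) i) p.1,
    lt (sval (sval d) i) p.2 & ~ comparable_in lt p.1 p.2].
  have [h dh] := hasht (sval (sval d) i); have [k hk] := omega1_successor h.
  by have [y [z [dy dz yz]]] := split_above _ h k dh hk (nonempty k); exists (y, z).
have cp : countable [set x | exists i, tle lt x (p i).1 \/ tle lt x (p i).2].
  apply: (@countable_cover 'I_n _ setT
    (fun i => [set x | tle lt x (p i).1 \/ tle lt x (p i).2])).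
  - exact: (countable_countType 'I_n).
  - by move=> i _; apply: countable_or; exact: countable_predecessors.
  - by move=> x [i xi]; exists i.
(* [xi] is chosen so that no entry of [a xi] is at or below a splitting node. *)
have [xi [Sxi dxi] xip] :=
  uncountable_setD (dP d (or_introl erefl)) (hits _ cp).
have /choice[e eP] i : exists y, tle lt (sval (sval d) i) y /\
    if g i then tle lt (a xi i) y else ~ comparable_in lt (a xi i) y.
  case: (g i).
    exists (sval (sval (b xi)) i); split; first exact: dle dxi.
    by right; exact: bP.
  have [dp1 dp2 np] := pP i; apply: contrapT => ne.
  (* If every node above the [i]-th entry of [d] were comparable with [a xi i], both splitting nodes
     would be below [a xi i], hence comparable with each other. *)
  have below y : lt (sval (sval d) i) y -> ~ tle lt (a xi i) y -> lt y (a xi i).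
    move=> dy nay; apply: contrapT => nya; apply: ne; exists y; split; first by right.
    by case=> [ay|ay|//]; apply: nay; [right | left].
  apply: np; apply: (tree_comparable (z := a xi i) tT); right; apply: below => // ap.
    by apply: xip; exists i => /=; exists i; left.
  by apply: xip; exists i => /=; exists i; right.
(* The nodes [e i] may differ in height; [e'] raises them to a common level and so is a node of the
   derived tree. *)
have [e' ee'] : exists e' : derived c', forall i, lt (e i) (sval (sval e') i).
  by apply: derive => i; have [de _] := eP i; exact: tle_trans (above d i) de.
have de' : derived_lt d e'.
  by move=> i; have [de _] := eP i; exact: tle_lt_trans de (ee' i).
have ce' : countable [set x | exists i, tle lt x (sval (sval e') i)].
  apply: (@countable_cover 'I_n _ setT (fun i => [set x | tle lt x (sval (sval e') i)])).
  - exact: (countable_countType 'I_n).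
  - by move=> i _; exact: countable_predecessors.
  - by move=> x [i xe]; exists i.
have cxi : countable [set beta | beta = xi \/ olt beta xi].
  by apply: countable_or; [exact: countable1 | exact: omega1_countable_initial].
(* [beta] comes after [xi], and no entry of [a beta] is at or below an entry of [e']. *)
have [beta [Sbeta e'b] bxi] :=
  uncountable_setD (dP e' (or_intror de')) (countable_or cxi (hits _ ce')).
exists xi, beta; split.
  by case: (olt_total xi beta) => // h; case: bxi; left; [left | right].
(* Both nodes are at or below the [i]-th entry of [b beta], hence comparable, and the choice of
   [beta] leaves only this order. *)
move=> i; have e'a : lt (sval (sval e') i) (a beta i).
  have := tree_comparable tT (dle _ _ i e'b) (or_intror (bP _ Sbeta i)).
  by case=> // h; case: bxi; right; exists i => /=; exists i; [left | right].
have ea := tr _ _ _ (ee' i) e'a; have [_] := eP i.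
case: (g i) => [ae|nae]; split=> //; first by move=> _; exact: tle_lt_trans ae ea.
(* Where [g] is false, [a xi i] below [a beta i] would be comparable with [e i], which is also below
   [a beta i]. *)
by move=> ab; case: nae; apply: (tree_comparable (z := a beta i) tT); right.
Qed.

Theorem theorem5p4 (T : Type) (lt : T -> T -> Prop)
    (T_suslin : suslin lt) (T_normal : normal lt) :
  (forall n : nat, 2 <= n -> (dim_entangled lt n <-> dim_free lt n)) /\
  (entangled lt <-> free lt).
Proof.
have [oT _ _] := T_suslin.
(* [entangled] and [free] start at dimension 1, so the equivalence is proved from there. *)
have equiv n : 1 <= n -> dim_entangled lt n <-> dim_free lt n.
  by move=> n0; split; [exact: entangled_free | exact: free_entangled].
split=> [n /ltnW|]; first exact: equiv.
by split=> h m m0; apply/equiv => //; exact: h.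
Qed.
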